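(* Let $R$ be an associative unital ring and $M$ an $R$-complex. There is a pure exact sequence in $\mathcal{C}(R)$ $$0\longrightarrow P\longrightarrow M\longrightarrow M/P\longrightarrow 0$$ with $P$ a pure-acyclic subcomplex of $M$ and $M/P$ pure-minimal. Consequently, the canonical map $M\to M/P$ is a pure quasi-isomorphism.
   Context: $R$-modules are left modules. An $R$-complex is a (possibly unbounded) chain complex $M$ of $R$-modules, indexed homologically; $Z_i(M)=\operatorname{Ker}(\partial_i^M)$; $\mathcal{C}(R)$ is the category of $R$-complexes and chain maps, with hom-sets $\operatorname{hom}_{\mathcal{C}(R)}(L,M)$. An exact sequence of $R$-modules is pure if $\operatorname{Hom}_R(A,-)$ leaves it exact for every finitely presented $R$-module $A$. An exact sequence $0\to L\to M\to N\to 0$ of $R$-complexes is pure if $0\to\operatorname{hom}_{\mathcal{C}(R)}(A,L)\to\operatorname{hom}_{\mathcal{C}(R)}(A,M)\to\operatorname{hom}_{\mathcal{C}(R)}(A,N)\to 0$ is exact for every bounded complex $A$ of finitely presented $R$-modules. A subcomplex $L\subseteq M$ is pure if $0\to L\to M\to M/L\to 0$ is pure. An $R$-complex $M$ is pure-acyclic if it is acyclic and $0\to Z_i(M)\to M_i\to Z_{i-1}(M)\to 0$ is a pure exact sequence of $R$-modules for every $i\in\mathbb{Z}$. An $R$-complex is pure-minimal if the zero complex is its only pure-acyclic pure subcomplex. A morphism of $R$-complexes is a pure quasi-isomorphism if its mapping cone is pure-acyclic. *)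

(* Defs.v *)
From HB Require Import structures.
From mathcomp Require Import all_boot all_algebra.

Set Implicit Arguments.
Unset Strict Implicit.
Unset Printing Implicit Defensive.

Import GRing.Theory.
Local Open Scope ring_scope.
Local Open Scope quotient_scope.

(* An associative unital ring is a pzRingType (the zero ring is allowed); a left
   R-module is an lmodType R. *)

(* Submodules are boolean predicates; under the axioms of mathcomp.classical
   every propositional submodule is of this form. *)
Record submodule (R : pzRingType) (V : lmodType R) := Submodule {
  smem : {pred V};
  smem_closed : submod_closed smem
}.

Section SubQuotientModules.
Variables (R : pzRingType) (V : lmodType R) (S : submodule V).

HB.instance Definition _ :=
  GRing.isSubmodClosed.Build R V (smem S) (smem_closed S).

Inductive submod_of : predArgType := InSubmod x & x \in smem S.
Definition submod_val (u : submod_of) : V := let: InSubmod x _ := u in x.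
HB.instance Definition _ := [isSub of submod_of for submod_val].
HB.instance Definition _ := [Choice of submod_of by <:].
HB.instance Definition _ := [SubChoice_isSubZmodule of submod_of by <:].
HB.instance Definition _ := [SubZmodule_isSubLmodule of submod_of by <:].

Lemma submod_valP (u : submod_of) : submod_val u \in smem S.
Proof. exact: valP. Qed.

Lemma submod_val_is_linear : linear submod_val.
Proof. by move=> a u v; rewrite -[submod_val]/(val) linearP. Qed.
HB.instance Definition _ :=
  GRing.isLinear.Build R submod_of V *:%R submod_val submod_val_is_linear.

(* The library's quotient of an additive group, with the R-action added. *)
Definition quotmod : Type := Quotient.quot (smem S).
HB.instance Definition _ := GRing.Zmodule.on quotmod.

Definition quotmod_pi (x : V) : quotmod := \pi_(Quotient.quot (smem S)) x.

Lemma quotmod_piP (x y : V) :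
  (quotmod_pi x = quotmod_pi y) <-> (x - y \in smem S).
Proof.
rewrite /quotmod_pi.
have -> : (x - y \in smem S) = (x == y %[mod Quotient.quot (smem S)]).
  exact: Quotient.idealrBE.
by split=> /eqP.
Qed.

Lemma quotmod_piD : {morph quotmod_pi : x y / x + y}.
Proof. by move=> x y; rewrite /quotmod_pi raddfD. Qed.

Definition quotmod_repr (q : quotmod) : V := repr (q : Quotient.quot (smem S)).

Lemma quotmod_reprK : cancel quotmod_repr quotmod_pi.
Proof. by move=> q; rewrite /quotmod_pi /quotmod_repr reprK. Qed.

Lemma quotmod_pi_surj (q : quotmod) : exists x, quotmod_pi x = q.
Proof. by exists (quotmod_repr q); rewrite quotmod_reprK. Qed.

Definition quotmod_scale (a : R) (q : quotmod) : quotmod :=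
  quotmod_pi (a *: quotmod_repr q).

Lemma quotmod_scaleE a x : quotmod_scale a (quotmod_pi x) = quotmod_pi (a *: x).
Proof.
apply/quotmod_piP; rewrite -scalerBr; apply: rpredZ.
by apply/quotmod_piP; rewrite quotmod_reprK.
Qed.

Lemma quotmod_scaleA a b q :
  quotmod_scale a (quotmod_scale b q) = quotmod_scale (a * b) q.
Proof.
by have [x <-] := quotmod_pi_surj q; rewrite !quotmod_scaleE scalerA.
Qed.

Lemma quotmod_scale1 : left_id 1 quotmod_scale.
Proof.
by move=> q; have [x <-] := quotmod_pi_surj q; rewrite quotmod_scaleE scale1r.
Qed.

Lemma quotmod_scaleDr : right_distributive quotmod_scale +%R.
Proof.
move=> a p q; have [x <-] := quotmod_pi_surj p; have [y <-] := quotmod_pi_surj q.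
by rewrite -quotmod_piD !quotmod_scaleE scalerDr quotmod_piD.
Qed.

Lemma quotmod_scaleDl q : {morph quotmod_scale^~ q : a b / a + b}.
Proof.
move=> a b; have [x <-] := quotmod_pi_surj q.
by rewrite !quotmod_scaleE scalerDl quotmod_piD.
Qed.

HB.instance Definition _ := GRing.Zmodule_isLmodule.Build R quotmod
  quotmod_scaleA quotmod_scale1 quotmod_scaleDr quotmod_scaleDl.

Lemma quotmod_pi_is_linear : linear quotmod_pi.
Proof.
move=> a x y; rewrite quotmod_piD; congr (_ + _).
by rewrite -quotmod_scaleE.
Qed.
HB.instance Definition _ :=
  GRing.isLinear.Build R V quotmod *:%R quotmod_pi quotmod_pi_is_linear.

End SubQuotientModules.

Section InducedMaps.
Variables (R : pzRingType) (U V : lmodType R).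

Section Kernel.
Variable f : {linear U -> V}.
Lemma ker_closed : submod_closed [pred x | f x == 0].
Proof.
split=> [|a x y]; rewrite !inE ?linear0 // => /eqP fx /eqP fy.
by rewrite linearP fx fy scaler0 addr0.
Qed.
Definition ker : submodule U := Submodule ker_closed.
End Kernel.

Section Corestriction.
Variables (f : {linear U -> V}) (T : submodule V).
Hypothesis fT : forall x, f x \in smem T.
Definition corestr (x : U) : submod_of T := InSubmod (fT x).
Lemma corestr_is_linear : linear corestr.
Proof. by move=> a x y; apply: val_inj; rewrite /= linearP. Qed.
HB.instance Definition _ :=
  GRing.isLinear.Build R U (submod_of T) *:%R corestr corestr_is_linear.
End Corestriction.

Section SubQuotient.
Variables (f : {linear U -> V}) (S : submodule U) (T : submodule V).
Hypothesis fST : forall x, x \in smem S -> f x \in smem T.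

Definition sub_map (u : submod_of S) : submod_of T :=
  InSubmod (fST (submod_valP u)).
Lemma sub_map_is_linear : linear sub_map.
Proof.
by move=> a x y; apply: val_inj; rewrite /= !linearP.
Qed.
HB.instance Definition _ := GRing.isLinear.Build R
  (submod_of S) (submod_of T) *:%R sub_map sub_map_is_linear.

(* Well defined by fST, which the body does not use but the linear structure
   declared below needs. *)
Definition quot_map of (forall x, x \in smem S -> f x \in smem T) :
    quotmod S -> quotmod T :=
  fun q => quotmod_pi T (f (quotmod_repr q)).
Lemma quot_mapE x : quot_map fST (quotmod_pi S x) = quotmod_pi T (f x).
Proof.
apply/quotmod_piP; rewrite -linearB; apply: fST.
by apply/quotmod_piP; rewrite quotmod_reprK.
Qed.
Lemma quot_map_is_linear : linear (quot_map fST).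
Proof.
move=> a p q; have [x <-] := quotmod_pi_surj p; have [y <-] := quotmod_pi_surj q.
by rewrite -linearP !quot_mapE !linearP.
Qed.
HB.instance Definition _ := GRing.isLinear.Build R
  (quotmod S) (quotmod T) *:%R (quot_map fST) quot_map_is_linear.
End SubQuotient.

End InducedMaps.

Section PureExactModules.
Variable R : pzRingType.

(* There is an exact sequence R^m -> R^n -> A -> 0. *)
Definition finitely_presented (A : lmodType R) : Prop :=
  exists (m n : nat) (r : {linear 'rV[R]_m -> 'rV[R]_n})
         (p : {linear 'rV[R]_n -> A}),
    (forall x, p x = 0 <-> exists y, r y = x) /\ (forall a, exists x, p x = a).

Variables (U V W : lmodType R) (f : {linear U -> V}) (g : {linear V -> W}).

Definition short_exact : Prop :=
  [/\ forall x, f x = 0 -> x = 0,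
      forall y, g y = 0 <-> exists x, f x = y
    & forall z, exists y, g y = z].

(* exactness of 0 -> Hom_R(A,U) -> Hom_R(A,V) -> Hom_R(A,W) -> 0; equality of
   homomorphisms is pointwise *)
Definition hom_short_exact (A : lmodType R) : Prop :=
  [/\ forall h : {linear A -> U},
        (forall a, f (h a) = 0) -> forall a, h a = 0,
      forall h : {linear A -> V},
        (forall a, g (h a) = 0) <->
        exists k : {linear A -> U}, forall a, f (k a) = h a
    & forall h : {linear A -> W},
        exists k : {linear A -> V}, forall a, g (k a) = h a].

Definition pure_short_exact : Prop :=
  short_exact /\
  forall A : lmodType R, finitely_presented A -> hom_short_exact A.

End PureExactModules.

Record complex (R : pzRingType) := Complex {
  cobj :> int -> lmodType R;
  cdiff : forall i : int, {linear cobj i -> cobj (i - 1)};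
  cdiff_cdiff : forall (i : int) (x : cobj i), cdiff (i - 1) (cdiff i x) = 0
}.
Arguments cdiff {R} _ _.

Record chain_map (R : pzRingType) (L M : complex R) := ChainMap {
  cmap :> forall i : int, {linear L i -> M i};
  cmap_cdiff : forall (i : int) (x : L i),
    cdiff M i (cmap i x) = cmap (i - 1) (cdiff L i x)
}.

Record subcomplex (R : pzRingType) (M : complex R) := Subcomplex {
  subobj :> forall i : int, submodule (M i);
  subobj_cdiff : forall (i : int) (x : M i),
    x \in smem (subobj i) -> cdiff M i x \in smem (subobj (i - 1))
}.

Section SubQuotientComplexes.
Variables (R : pzRingType) (M : complex R) (P : subcomplex M).

Definition sub_cdiff (i : int) :
    {linear submod_of (P i) -> submod_of (P (i - 1))} :=
  sub_map (subobj_cdiff (s := P) (i := i)).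
Lemma sub_cdiff_cdiff i x : sub_cdiff (i - 1) (sub_cdiff i x) = 0.
Proof. by apply: val_inj; rewrite /= cdiff_cdiff. Qed.
Definition sub_complex : complex R :=
  @Complex R (fun i => submod_of (P i)) sub_cdiff sub_cdiff_cdiff.

Definition quot_cdiff (i : int) : {linear quotmod (P i) -> quotmod (P (i - 1))} :=
  quot_map (subobj_cdiff (s := P) (i := i)).
Lemma quot_cdiff_cdiff i q : quot_cdiff (i - 1) (quot_cdiff i q) = 0.
Proof.
have [x <-] := quotmod_pi_surj q; rewrite /quot_cdiff /= !quot_mapE.
by rewrite cdiff_cdiff linear0.
Qed.
Definition quot_complex : complex R :=
  @Complex R (fun i => quotmod (P i)) quot_cdiff quot_cdiff_cdiff.

Lemma sub_incl_cdiff i (x : sub_complex i) :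
  cdiff M i (submod_val x) = submod_val (cdiff sub_complex i x).
Proof. by []. Qed.
Definition sub_incl : chain_map sub_complex M :=
  @ChainMap R sub_complex M (fun i => @submod_val R (M i) (P i)) sub_incl_cdiff.

Lemma quot_proj_cdiff i (x : M i) :
  cdiff quot_complex i (quotmod_pi (P i) x) = quotmod_pi (P (i - 1)) (cdiff M i x).
Proof. exact: quot_mapE. Qed.
Definition quot_proj : chain_map M quot_complex :=
  @ChainMap R M quot_complex (fun i => quotmod_pi (P i)) quot_proj_cdiff.

End SubQuotientComplexes.

Section PureExactComplexes.
Variable R : pzRingType.

Definition bounded (A : complex R) : Prop :=
  exists b : int, forall i : int, b < `|i| -> forall x : A i, x = 0.

Variables (L M N : complex R) (f : chain_map L M) (g : chain_map M N).

Definition chain_short_exact : Prop := forall i : int, short_exact (f i) (g i).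

(* exactness of 0 -> hom(A,L) -> hom(A,M) -> hom(A,N) -> 0, for hom-sets in the
   category of complexes; equality of chain maps is pointwise *)
Definition chain_hom_short_exact (A : complex R) : Prop :=
  [/\ forall h : chain_map A L,
        (forall i a, f i (h i a) = 0) -> forall i a, h i a = 0,
      forall h : chain_map A M,
        (forall i a, g i (h i a) = 0) <->
        exists k : chain_map A L, forall i a, f i (k i a) = h i a
    & forall h : chain_map A N,
        exists k : chain_map A M, forall i a, g i (k i a) = h i a].

Definition chain_pure_short_exact : Prop :=
  chain_short_exact /\
  forall A : complex R, bounded A -> (forall i, finitely_presented (A i)) ->
    chain_hom_short_exact A.

End PureExactComplexes.

Section PureAcyclic.
Variables (R : pzRingType) (M : complex R).

Definition cycles (i : int) : submodule (M i) := ker (cdiff M i).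

Lemma cdiff_cycles i (x : M i) : cdiff M i x \in smem (cycles (i - 1)).
Proof. by rewrite inE cdiff_cdiff. Qed.

Definition cycles_incl (i : int) : {linear submod_of (cycles i) -> M i} :=
  @submod_val R (M i) (cycles i).
Definition to_cycles (i : int) : {linear M i -> submod_of (cycles (i - 1))} :=
  corestr (cdiff_cycles (i := i)).

(* Exactness at M_(i-1), for every i. Degrees are shifted by one so that the
   differential M_i -> M_(i-1) needs no transport of types. *)
Definition acyclic : Prop :=
  forall (i : int) (x : M (i - 1)),
    cdiff M (i - 1) x = 0 <-> exists y : M i, cdiff M i y = x.

Definition pure_acyclic : Prop :=
  acyclic /\
  forall i : int, pure_short_exact (cycles_incl i) (to_cycles i).

End PureAcyclic.

Definition pure_subcomplex (R : pzRingType) (M : complex R) (P : subcomplex M) :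
    Prop :=
  chain_pure_short_exact (sub_incl P) (quot_proj P).

Definition pure_minimal (R : pzRingType) (M : complex R) : Prop :=
  forall P : subcomplex M,
    pure_subcomplex P -> pure_acyclic (sub_complex P) ->
    forall (i : int) (x : M i), x \in smem (P i) -> x = 0.

Section MappingCone.
Variables (R : pzRingType) (M N : complex R) (f : chain_map M N).

(* Cone(f)_i = N_i + M_(i-1), with differential
   (n, m) |-> (d n + f m, - d m). *)
Definition cone_obj (i : int) : lmodType R := (N i * M (i - 1)%R)%type.

Definition cone_diff (i : int) (u : cone_obj i) : cone_obj (i - 1) :=
  (cdiff N i u.1 + f (i - 1) u.2, - cdiff M (i - 1) u.2).

Lemma cone_diff_is_linear i : linear (@cone_diff i).
Proof.
move=> a [n m] [n' m']; rewrite /cone_diff /= !linearP; congr pair => /=.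
  by rewrite scalerDr addrACA.
Qed.
HB.instance Definition _ (i : int) := GRing.isLinear.Build R
  (cone_obj i) (cone_obj (i - 1)) *:%R (@cone_diff i) (@cone_diff_is_linear i).

Lemma cone_diff_diff i (u : cone_obj i) : cone_diff (cone_diff u) = 0.
Proof.
case: u => n m; rewrite /cone_diff /=; congr pair => /=.
  by rewrite linearD cdiff_cdiff add0r cmap_cdiff linearN subrr.
by rewrite linearN cdiff_cdiff oppr0 oppr0.
Qed.

Definition cone : complex R :=
  @Complex R cone_obj (fun i => @cone_diff i) cone_diff_diff.

End MappingCone.

Definition pure_quasi_iso (R : pzRingType) (M N : complex R)
    (f : chain_map M N) : Prop :=
  pure_acyclic (cone f).

(* Main.v *)
Require Import Defs.
From mathcomp Require Import all_boot all_algebra.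
From mathcomp Require Import all_order boolp classical_sets.
From HB Require Import structures.

Set Implicit Arguments.
Unset Strict Implicit.
Unset Printing Implicit Defensive.

Import Order.TTheory GRing.Theory Num.Theory.
Local Open Scope ring_scope.

(** The subcomplex [P] is a maximal one, by Zorn's lemma, among the
pure-acyclic pure subcomplexes of [M].

Both conditions on a subcomplex [P] can be tested one finitely presented
module [A] at a time, using only linear maps out of [A].  Pure acyclicity says
that the complex of groups Hom(A, P) is acyclic ([pure_acyclicP]).  In its
presence, purity in the category of complexes reduces to purity of [P i] in
[M i] for each [i]: one direction uses the complexes [A = A] concentrated in
two adjacent degrees ([pure_subcomplex_degreewise]); for the other, a morphism
from a bounded complex to [M / P] is lifted in each degree separately, and the
lifts are then corrected by maps into [P], from the lowest degree upwards, so
as to commute with the differentials ([good_subcomplex_lift]).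

The degreewise conditions, called [good_subcomplex] below, are stable under
two constructions.  They pass to unions of chains, because a map out of a
finitely presented module involves only finitely many generators and relations
([good_subcomplex_directed_union]); hence a maximal [P] exists.  And they pass
from [P] in [M] and [Q] in [M / P] to the preimage of [Q] in [M]
([good_subcomplex_preim]); so a nonzero pure-acyclic pure subcomplex of [M / P]
would contradict maximality, and [M / P] is pure-minimal.

Finally, the cone of the projection from [M] to [M / P] is pure-acyclic because
[P] is, by a direct chase ([quot_proj_pure_quasi_iso]). *)

(** * Linear maps and finitely presented modules *)

Section LinearMaps.
Variable R : pzRingType.
Implicit Types U V W A B : lmodType R.

(** Linear maps defined by choice or by a formula inside a proof are turned into
bundled ones through this existence statement. *)
Lemma linear_bundle U V (f : U -> V) :
  linear f -> exists g : {linear U -> V}, forall x, g x = f x.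
Proof.
move=> f_lin; pose mf := GRing.isLinear.Build R U V *:%R f f_lin.
by exists (HB.pack_for {linear U -> V} f mf).
Qed.

Lemma quotmod_pi_eq0 V (S : submodule V) (x : V) :
  quotmod_pi S x = 0 <-> x \in smem S.
Proof.
by rewrite -[X in _ = X](linear0 (quotmod_pi S)) quotmod_piP subr0.
Qed.

Lemma corestr_lift U V (f : {linear U -> V}) (T : submodule V) :
  (forall x, f x \in smem T) ->
  exists g : {linear U -> submod_of T}, forall x, submod_val (g x) = f x.
Proof. by move=> fT; exists (corestr fT). Qed.

Lemma linear_eq_delta V n (f g : {linear 'rV[R]_n -> V}) :
  (forall j, f (delta_mx 0 j) = g (delta_mx 0 j)) -> forall v, f v = g v.
Proof.
move=> fg v; rewrite [v]row_sum_delta !linear_sum.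
by apply: eq_bigr => j _; rewrite !linearZ /= fg.
Qed.

Lemma linear_of_basis V n (x : 'I_n -> V) :
  exists f : {linear 'rV[R]_n -> V}, forall j, f (delta_mx 0 j) = x j.
Proof.
have [|f fE] := @linear_bundle 'rV[R]_n V (fun v => \sum_j v 0 j *: x j).
  move=> a u v; rewrite scaler_sumr -big_split /=.
  by apply: eq_bigr => j _; rewrite !mxE scalerDl scalerA.
exists f => j; rewrite fE (bigD1 j) //= mxE !eqxx scale1r big1 ?addr0 // => k.
by move=> /negbTE kj; rewrite mxE kj andbF scale0r.
Qed.

Lemma linear_lift_free V W (g : {linear V -> W}) n (h : {linear 'rV[R]_n -> W}) :
  (forall w, exists v, g v = w) ->
  exists k : {linear 'rV[R]_n -> V}, forall x, g (k x) = h x.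
Proof.
move=> g_surj; have [x xE] := choice (fun j => g_surj (h (delta_mx 0 j))).
have [k kE] := linear_of_basis x; exists k.
by apply: (linear_eq_delta (f := g \o k)) => j; rewrite /= kE xE.
Qed.

Lemma linear_descend U V W (p : {linear U -> V}) (f : {linear U -> W}) :
  (forall v, exists u, p u = v) -> (forall u, p u = 0 -> f u = 0) ->
  exists g : {linear V -> W}, forall u, g (p u) = f u.
Proof.
move=> p_surj pf; have [s sK] := choice p_surj.
have fs u : f (s (p u)) = f u.
  by apply/eqP; rewrite -subr_eq0 -linearB pf // linearB sK subrr.
have [|g gE] := @linear_bundle V W (f \o s).
  by move=> a x y /=; rewrite -{1}(sK x) -{1}(sK y) -linearP fs linearP.
by exists g => u; rewrite gE /= fs.
Qed.

Lemma finitely_presented_free n : finitely_presented 'rV[R]_n.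
Proof.
exists 0, n, \0, idfun; split=> [x|a]; last by exists a.
by split=> [/= ->|[y /= <-//]]; exists 0.
Qed.

(** The kernel of [f \o p] is that of [p], so the same relations present [B]. *)
Lemma finitely_presented_iso A B (f : {linear A -> B}) :
  (forall a, f a = 0 -> a = 0) -> (forall b, exists a, f a = b) ->
  finitely_presented A -> finitely_presented B.
Proof.
move=> f_inj f_surj [m [n [r [p [pr p_surj]]]]].
exists m, n, r, (f \o p); split=> [x|b]; last first.
  by have [a <-] := f_surj b; have [x <-] := p_surj a; exists x.
rewrite -pr /=; split=> [/f_inj //|->]; exact: linear0.
Qed.

Lemma finitely_presented_trivial A :
  (forall a : A, a = 0) -> finitely_presented A.
Proof.
move=> A0; have triv : forall v : 'rV[R]_0, v = 0 by move=> v; apply: thinmx0.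
apply: (finitely_presented_iso (f := \0) _ _ (finitely_presented_free 0)).
  by move=> v _.
by move=> a; exists 0; rewrite (A0 a).
Qed.

End LinearMaps.

(** * Pure submodules *)

Section PureSubmodules.
Variable R : pzRingType.
Implicit Types A V : lmodType R.

(** Only surjectivity of Hom(A, V) -> Hom(A, V / S) is recorded: the rest of the
exactness that purity demands holds for every submodule, since Hom(A, -) is left
exact. *)
Definition pure_submodule V (S : submodule V) : Prop :=
  forall A : lmodType R, finitely_presented A ->
  forall h : {linear A -> quotmod S},
  exists k : {linear A -> V}, forall a, quotmod_pi S (k a) = h a.

(** Each of the [n] generators of [A] is sent into some member of the family, and
a common upper bound of these finitely many members contains the whole image. *)
Lemma fin_gen_directed_union V (I : Type) (S : I -> submodule V) (T : submodule V)
    A n (p : {linear 'rV[R]_n -> A}) (f : {linear A -> V}) :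
  inhabited I ->
  (forall a b, exists c, forall x,
     x \in smem (S a) \/ x \in smem (S b) -> x \in smem (S c)) ->
  (forall x, x \in smem T <-> exists a, x \in smem (S a)) ->
  (forall a, exists x, p x = a) ->
  (forall a, f a \in smem T) ->
  exists c, forall a, f a \in smem (S c).
Proof.
move=> [i0] dirS TE p_surj fT.
have fin (s : seq 'I_n) :
    exists c, forall j, j \in s -> f (p (delta_mx 0 j)) \in smem (S c).
  elim: s => [|j s [c cP]]; first by exists i0.
  have [b bP] := (TE _).1 (fT (p (delta_mx 0 j))).
  have [d dP] := dirS b c; exists d => k; rewrite in_cons => /orP[/eqP->|ks].
    by apply: dP; left.
  by apply: dP; right; apply: cP.
have [c cP] := fin (enum 'I_n); exists c => a; have [v <-] := p_surj a.
rewrite [v]row_sum_delta !linear_sum; apply: rpred_sum => j _.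
by rewrite !linearZ; apply: rpredZ; apply: cP; rewrite mem_enum.
Qed.

(** Lift [h] to a map from the free module on the generators of [A] to [V].  It
sends the finitely many relations of [A] into [T], hence into a single [S c], so
it induces a map from [A] to the quotient by [S c].  A lift of the latter along
[S c] is a lift of [h]. *)
Lemma pure_directed_union V (I : Type) (S : I -> submodule V) (T : submodule V) :
  inhabited I ->
  (forall a b, exists c, forall x,
     x \in smem (S a) \/ x \in smem (S b) -> x \in smem (S c)) ->
  (forall x, x \in smem T <-> exists a, x \in smem (S a)) ->
  (forall a, pure_submodule (S a)) -> pure_submodule T.
Proof.
move=> I0 dirS TE S_pure A fpA h.
have [m [n [r [p [pr p_surj]]]]] := fpA.
have [f fE] := linear_lift_free (h \o p) (@quotmod_pi_surj _ _ T).
have frT y : f (r y) \in smem T.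
  by apply/quotmod_pi_eq0; rewrite fE /= (pr _).2 ?linear0 //; exists y.
have [||c cP] := fin_gen_directed_union (p := idfun) (f := f \o r) I0 dirS TE.
- by move=> a; exists a.
- exact: frT.
have [||g gE] := linear_descend (p := p) (f := quotmod_pi (S c) \o f).
- exact: p_surj.
- by move=> u /pr[y <-]; apply/quotmod_pi_eq0/cP.
have [k kE] := S_pure c A fpA g; exists k => a.
have [v <-] := p_surj a; rewrite -[RHS]/((h \o p) v) -fE.
apply/quotmod_piP/TE; exists c; apply/quotmod_piP.
by rewrite kE gE.
Qed.

Lemma pure_submodule_zero V (S : submodule V) :
  (forall x, x \in smem S -> x = 0) -> pure_submodule S.
Proof.
move=> S0 A _ h.
have [||g gE] := linear_descend (p := quotmod_pi S) (f := idfun).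
- exact: quotmod_pi_surj.
- by move=> x /quotmod_pi_eq0/S0.
exists (g \o h) => a /=; have [x <-] := quotmod_pi_surj (h a).
by rewrite gE.
Qed.

(** By the third isomorphism theorem [V / T] is [(V / S) / Q], so a map into
[V / T] is lifted in two stages, along [Q] and then along [S]. *)
Lemma pure_submodule_preim V (S : submodule V) (Q : submodule (quotmod S))
    (T : submodule V) :
  (forall x, x \in smem T <-> quotmod_pi S x \in smem Q) ->
  pure_submodule S -> pure_submodule Q -> pure_submodule T.
Proof.
move=> TE S_pure Q_pure A fpA h.
have [||g gE] := linear_descend (p := quotmod_pi T)
    (f := quotmod_pi Q \o quotmod_pi S).
- exact: quotmod_pi_surj.
- by move=> x /quotmod_pi_eq0/TE xQ; apply/quotmod_pi_eq0.
have [k kE] := Q_pure A fpA (g \o h); have [l lE] := S_pure A fpA k.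
exists l => a; have [x xE] := quotmod_pi_surj (h a).
rewrite -xE; apply/quotmod_piP/TE; rewrite linearB /=; apply/quotmod_piP.
by rewrite lE kE /= -xE gE.
Qed.

End PureSubmodules.

(** * Pure acyclicity as acyclicity under Hom *)

Section HomAcyclic.
Variable R : pzRingType.

Definition hom_acyclic (M : complex R) : Prop :=
  forall A : lmodType R, finitely_presented A ->
  forall (i : int) (f : {linear A -> M (i - 1)}),
    (forall a, cdiff M (i - 1) (f a) = 0) ->
    exists g : {linear A -> M i}, forall a, cdiff M i (g a) = f a.

(** Purity of the sequences of cycles says that maps from [A] to the cycles in
degree [i - 1] lift along the differential, which is exactness of Hom(A, M).
Taking [A] free of rank one recovers acyclicity of [M] itself. *)
Lemma pure_acyclicP (M : complex R) : pure_acyclic M <-> hom_acyclic M.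
Proof.
split=> [[_ Mpure] A fpA i f df0|Mac].
  have [h hE] := corestr_lift (f := f) (T := cycles M (i - 1))
    (fun a => introT eqP (df0 a)).
  have [_ /(_ A fpA)[_ _ /(_ h)[k kE]]] := Mpure i.
  by exists k => a; rewrite -hE -kE.
have Mex : acyclic M.
  move=> i x; split=> [dx0|[y <-]]; last exact: cdiff_cdiff.
  (* an element is a linear map out of a free module of rank one *)
  have [f fE] := linear_of_basis (fun _ : 'I_1 => x).
  have [|g gE] := Mac _ (finitely_presented_free R 1) i f.
    apply: (linear_eq_delta (f := cdiff M (i - 1) \o f) (g := \0)) => j /=.
    by rewrite fE.
  by exists (g (delta_mx 0 0)); rewrite gE fE.
split=> // i; split.
  split=> [x x0|y|[z zZ]].
  - by apply: val_inj.
  - split=> [[dy0]|[[x xZ] <-]]; last by apply/val_inj/eqP.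
    by exists (InSubmod (introT eqP dy0 : y \in smem (cycles M i))).
  - have [y yE] := (Mex i z).1 (eqP zZ).
    by exists y; apply: val_inj.
move=> A fpA; split=> [h h0 a|h|h].
- by apply: val_inj; apply: h0.
- split=> [dh0|[k kE] a]; last first.
    by apply: val_inj; rewrite /= -kE; apply/eqP: (submod_valP (k a)).
  apply: (corestr_lift (T := cycles M i)) => a.
  by apply/eqP; have /(congr1 (@submod_val _ _ _)) := dh0 a.
- have [|g gE] := Mac A fpA i (cycles_incl M (i - 1) \o h).
    by move=> a; apply/eqP: (submod_valP (h a)).
  by exists g => a; apply: val_inj; rewrite /= gE.
Qed.

(** Maps into the submodules [P i] are traded for maps into [M i] with values
in [P i], which can be added to other maps into [M i]. *)
Lemma hom_acyclic_subP (M : complex R) (P : subcomplex M) :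
  hom_acyclic (sub_complex P) <->
  forall A : lmodType R, finitely_presented A ->
  forall (i : int) (f : {linear A -> M (i - 1)}),
    (forall a, f a \in smem (P (i - 1))) ->
    (forall a, cdiff M (i - 1) (f a) = 0) ->
    exists g : {linear A -> M i},
      (forall a, g a \in smem (P i)) /\ forall a, cdiff M i (g a) = f a.
Proof.
split=> Pac A fpA i f.
  move=> fP df0; have [h hE] := corestr_lift fP.
  have [|g gE] := Pac A fpA i h.
    by move=> a; apply: val_inj; rewrite /= hE df0.
  exists (@submod_val _ _ _ \o g); split=> a; first exact: submod_valP.
  by rewrite -hE -gE.
move=> df0; have [||g [gP gE]] := Pac A fpA i (@submod_val _ _ _ \o f).
- by move=> a; apply: submod_valP.
- by move=> a; have /(congr1 (@submod_val _ _ _)) := df0 a.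
have [k kE] := corestr_lift gP; exists k => a.
by apply: val_inj; rewrite /= kE gE.
Qed.

End HomAcyclic.

(** * The disc complex on a module *)

Section Disc.
Variables (R : pzRingType) (A : lmodType R) (i : int).

(** The disc is [A] in degrees [i] and [i - 1], joined by the identity, and zero
elsewhere.  Its terms are built as submodules of [A], so that no transport along
equalities of degrees enters its definition. *)
Definition disc_mem (k : int) : {pred A} :=
  [pred x | [|| k == i, k == i - 1 | x == 0]].

Lemma disc_closed k : submod_closed (disc_mem k).
Proof.
split=> [|a x y]; rewrite !inE ?eqxx ?orbT //.
case: (k == i) (k == i - 1) => [] [] //= /eqP-> /eqP->.
by rewrite scaler0 addr0.
Qed.

Definition disc_obj k : submodule A := Submodule (disc_closed k).

Definition disc_fun k (x : A) : A := if k == i then x else 0.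

Lemma disc_fun_linear k : linear (disc_fun k).
Proof. by move=> a x y; rewrite /disc_fun; case: ifP; rewrite ?scaler0 ?addr0. Qed.
HB.instance Definition _ k :=
  GRing.isLinear.Build R A A *:%R (disc_fun k) (disc_fun_linear k).

Lemma disc_fun_mem k x :
  x \in smem (disc_obj k) -> disc_fun k x \in smem (disc_obj (k - 1)).
Proof.
by move=> _; rewrite !inE /disc_fun; case: (eqVneq k i) => [->|_];
  rewrite eqxx ?orbT.
Qed.

Definition disc_diff k :
    {linear submod_of (disc_obj k) -> submod_of (disc_obj (k - 1))} :=
  Defs.sub_map (f := disc_fun k : {linear A -> A}) (disc_fun_mem (k := k)).

Lemma disc_diff_diff k x : disc_diff (k - 1) (disc_diff k x) = 0.
Proof.
apply: val_inj; rewrite /= /disc_fun; case: (eqVneq k i) => [ki|_]; last by case: ifP.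
by rewrite {1}ki -subr_eq0 addrAC subrr.
Qed.

Definition disc : complex R := Complex disc_diff_diff.

Lemma disc_bounded : bounded disc.
Proof.
exists (`|i| + 1) => k; rewrite ltNge => ik x; apply: val_inj; apply/eqP.
have := submod_valP x; rewrite inE => /or3P[/eqP ki|/eqP ki|//].
  by case/negP: ik; rewrite ki lerDl.
by case/negP: ik; rewrite ki (le_trans (ler_normB _ _)) // normr1.
Qed.

Lemma disc_fp : finitely_presented A -> forall k, finitely_presented (disc k).
Proof.
move=> fpA k; have [kP|kP] := boolP ((k == i) || (k == i - 1)); last first.
  apply: finitely_presented_trivial => x; apply: val_inj; apply/eqP.
  by have := submod_valP x; rewrite inE orbA (negbTE kP).
have [|f fE] := corestr_lift (f := idfun : {linear A -> A}) (T := disc_obj k).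
  by move=> x; rewrite inE orbA kP.
apply: (finitely_presented_iso (f := f)) fpA => [a|b].
  by move=> /(congr1 (@submod_val _ _ _)); rewrite fE.
by exists (submod_val b); apply: val_inj; rewrite /= fE.
Qed.

(** The disc represents the functor [N |-> Hom(A, N i)]: the map in degree
[i - 1] is forced to be the differential of [N] after [h]. *)
Lemma disc_map (N : complex R) (h : {linear A -> N i}) :
  exists f : chain_map disc N, forall x, f i x = h (submod_val x).
Proof.
(* The transports relate the component in a variable degree [k] to maps into
   [N i] and [N (i - 1)]; they disappear once [k] is replaced by either. *)
have comp k : exists u : {linear disc k -> N k},
    [/\ forall e : i = k, forall x, u x = ecast j (N j) e (h (submod_val x)),
        forall e : i - 1 = k, forall x,
          u x = ecast j (N j) e (cdiff N i (h (submod_val x)))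
      & k != i -> k != i - 1 -> forall x, u x = 0].
  have i1 : i != i - 1 by rewrite -subr_eq0 opprB addrC subrK.
  case: (eqVneq k i) => [->|ki].
    exists (h \o @submod_val _ _ _); split=> // e; last by case/eqP: i1.
    by rewrite (eq_axiomK e).
  case: (eqVneq k (i - 1)) => [->|ki1].
    exists (cdiff N i \o (h \o @submod_val _ _ _)); split=> // e.
      by case/eqP: i1.
    by rewrite (eq_axiomK e).
  by exists \0; split=> // e; [case/eqP: ki | case/eqP: ki1].
pose u k := sval (cid (comp k)).
have uP k := svalP (cid (comp k)).
have u_comm k (x : disc k) : cdiff N k (u k x) = u (k - 1) (cdiff disc k x).
  have [u1 u2 u0] := uP k; have [v1 v2 v0] := uP (k - 1).
  have d0 : k != i -> cdiff disc k x = 0.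
    by move=> /negbTE ki; apply: val_inj; rewrite /= /disc_fun ki.
  case: (eqVneq k i) => [ki|ki]; last rewrite d0 // linear0.
    case: _ / (esym ki) in x u1 u2 u0 v1 v2 v0 d0 *.
    by rewrite (u1 erefl) (v2 erefl) /= /disc_fun eqxx.
  case: (eqVneq k (i - 1)) => [ki1|ki1]; last by rewrite u0 // linear0.
  case: _ / (esym ki1) in x ki u1 u2 u0 v1 v2 v0 d0 *.
  by rewrite (u2 erefl) /= cdiff_cdiff.
exists (ChainMap u_comm) => x /=; by have [/(_ erefl)] := uP i.
Qed.

End Disc.

(** * Pure-acyclic pure subcomplexes *)

Section GoodSubcomplexes.
Variable R : pzRingType.
Implicit Types M : complex R.

(** A map from [A] to [M i / P i] is a chain map from the disc on [A] to
[M / P]; the degree [i] part of its lift to [M] is the lift wanted. *)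
Lemma pure_subcomplex_degreewise M (P : subcomplex M) :
  pure_subcomplex P -> forall i, pure_submodule (P i).
Proof.
move=> [_ Ppure] i A fpA h.
have [_ _ lift] := Ppure (disc A i) (disc_bounded A i) (disc_fp i fpA).
have [f fE] := @disc_map _ A i (quot_complex P) h; have [g gE] := lift f.
have [|e eE] := corestr_lift (f := idfun : {linear A -> A}) (T := disc_obj A i i).
  by move=> x; rewrite inE eqxx.
by exists (g i \o e) => a; rewrite [LHS](gE i (e a)) fE eE.
Qed.

(** This describes the pure-acyclic pure subcomplexes in terms of linear maps
alone: see [good_subcomplex_pure] and [pure_subcomplex_degreewise] for purity,
[pure_acyclicP] for pure acyclicity. *)
Definition good_subcomplex M (P : subcomplex M) : Prop :=
  (forall i, pure_submodule (P i)) /\ hom_acyclic (sub_complex P).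

(** Purity in each degree gives linear maps [g i] lifting [h i], which commute
with the differentials only modulo [P].  If they commute below degree [j], the
defect [d g_j - g_(j-1) d] is a map from [A j] to cycles of [P], hence equals
[d p] for some [p : A j -> P j]; subtracting [p] from [g j] makes the family
commute in degree [j] without disturbing the degrees below.  As [A] is bounded,
finitely many such corrections suffice. *)
Lemma good_subcomplex_lift M (P : subcomplex M) (A : complex R) :
  good_subcomplex P -> bounded A -> (forall i, finitely_presented (A i)) ->
  forall h : chain_map A (quot_complex P),
  exists k : chain_map A M, forall i a, quot_proj P i (k i a) = h i a.
Proof.
move=> [Ppure /hom_acyclic_subP Pac] [b Ab] fpA h.
pose lifts (g : forall i, {linear A i -> M i}) :=
  forall i a, quotmod_pi (P i) (g i a) = h i a.
pose commutes (g : forall i, {linear A i -> M i}) (i : int) :=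
  forall a, cdiff M i (g i a) = g (i - 1) (cdiff A i a).
have A0 (i : int) : i < - b \/ b < i -> forall a : A i, a = 0.
  move=> ib; apply: Ab; rewrite lter_normr.
  by case: ib => [|->//]; rewrite ltrNr => ->; rewrite orbT.
have step g (j : int) : lifts g -> (forall i : int, i < j -> commutes g i) ->
    exists2 g', lifts g' & forall i : int, i < j + 1 -> commutes g' i.
  move=> gl gc; have [||p [pP pE]] := Pac (A j) (fpA j) j
      ((cdiff M j \o g j) \- (g (j - 1) \o cdiff A j)).
  - move=> a /=; apply/quotmod_pi_eq0; rewrite linearB /= gl -quot_proj_cdiff gl.
    by apply/eqP; rewrite subr_eq0; apply/eqP/(cmap_cdiff h).
  - have j1 : j - 1 < j by rewrite gtrDl.
    by move=> a /=; rewrite linearB /= cdiff_cdiff gc // cdiff_cdiff linear0 subrr.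
  (* [g] corrected in degree [j] only *)
  have comp i : exists u : {linear A i -> M i},
      [/\ forall a, quotmod_pi (P i) (u a) = h i a,
          i <> j -> u = g i
        & i = j -> forall a, cdiff M i (u a) = g (i - 1) (cdiff A i a)].
    case: (eqVneq i j) => [->|/eqP ij]; last by exists (g i).
    exists (g j \- p); split=> // [a|_ a] /=.
      by rewrite linearB /= gl (quotmod_pi_eq0 _ _).2 ?subr0.
    by rewrite linearB /= pE /= subKr.
  pose g' i := sval (cid (comp i)); have g'P i := svalP (cid (comp i)).
  exists g' => [i a|i]; first by have [] := g'P i.
  rewrite ltzD1 => ij a; have [_ g1 g2] := g'P i; have [_ g3 _] := g'P (i - 1).
  rewrite /g' g3; last by apply/eqP; rewrite lt_eqF // (lt_le_trans _ ij) // gtrDl.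
  case: (eqVneq i j) => [/g2->//|ij']; rewrite g1; last exact/eqP.
  by apply: gc; rewrite lt_neqAle ij'.
have lift0 : exists2 g, lifts g & forall i : int, i < - b -> commutes g i.
  have comp i := Ppure i _ (fpA i) (h i).
  exists (fun i => sval (cid (comp i))) => [i|i ib a].
    exact: (svalP (cid (comp i))).
  by rewrite (A0 i (or_introl ib) a) !linear0.
have liftn n : exists2 g, lifts g & forall i : int, i < - b + n%:Z -> commutes g i.
  elim: n => [|n [g gl gc]]; first by rewrite addr0.
  by have [g' g'l g'c] := step g _ gl gc; exists g'; rewrite // intS addrCA addrC.
(* The degrees from [- b] to [b] are those where [A] may be nonzero. *)
have [g gl gc] := liftn (absz (b + b + 1)%R).
have g_comm i a : cdiff M i (g i a) = g (i - 1) (cdiff A i a).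
  case: (ltP b i) => [bi|ib]; first by rewrite (A0 i (or_intror bi) a) !linear0.
  apply: gc; rewrite -ltrBlDl opprK; apply: lt_le_trans (lez_abs _).
  by rewrite ltzD1 addrC lerD2l.
by exists (ChainMap g_comm).
Qed.

Lemma good_subcomplex_pure M (P : subcomplex M) :
  good_subcomplex P -> pure_subcomplex P.
Proof.
move=> Pgood; split=> [i|A Ab fpA]; split.
- by move=> x x0; apply: val_inj.
- move=> y; rewrite quotmod_pi_eq0; split=> [yP|[x <-]]; last exact: submod_valP.
  by exists (InSubmod yP).
- exact: quotmod_pi_surj.
- by move=> h h0 i a; apply: val_inj; apply: h0.
- move=> h; split=> [h0|[k kE] i a]; last first.
    by apply/quotmod_pi_eq0; rewrite -kE; apply: submod_valP.
  have hP i a : h i a \in smem (P i) by apply/quotmod_pi_eq0/h0.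
  have k_comm i (a : A i) : cdiff (sub_complex P) i (corestr (hP i) a)
      = corestr (hP (i - 1)) (cdiff A i a).
    by apply: val_inj; rewrite /= cmap_cdiff.
  by exists (ChainMap (M := sub_complex P) (cmap := fun i => corestr (hP i)) k_comm).
- exact: good_subcomplex_lift.
Qed.

(** A map from [A] to cycles of the union lands in one member of the family,
and it already bounds there. *)
Lemma good_subcomplex_directed_union M (I : Type) (S : I -> subcomplex M)
    (P : subcomplex M) :
  inhabited I ->
  (forall a b, exists c, forall i x,
     x \in smem (S a i) \/ x \in smem (S b i) -> x \in smem (S c i)) ->
  (forall i x, x \in smem (P i) <-> exists a, x \in smem (S a i)) ->
  (forall a, good_subcomplex (S a)) -> good_subcomplex P.
Proof.
move=> I0 dirS PE Sgood.
have dirSi i a b : exists c, forall x,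
    x \in smem (S a i) \/ x \in smem (S b i) -> x \in smem (S c i).
  by have [c cP] := dirS a b; exists c; apply: cP.
split=> [i|].
  apply: (pure_directed_union I0 (dirSi i) (PE i)) => a.
  by have [] := Sgood a.
apply/hom_acyclic_subP => A fpA i f fP df0.
have [m [n [r [p [_ p_surj]]]]] := fpA.
have [c cP] := fin_gen_directed_union I0 (dirSi (i - 1)) (PE (i - 1)) p_surj fP.
have [_ /hom_acyclic_subP Sac] := Sgood c.
have [g [gS gE]] := Sac A fpA i f cP df0.
by exists g; split=> // a; apply/PE; exists c.
Qed.

Lemma good_subcomplex_zero M :
  exists P : subcomplex M, good_subcomplex P.
Proof.
have closed i : submod_closed [pred x : M i | x == 0].
  split=> [|a x y]; rewrite !inE // => /eqP-> /eqP->.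
  by rewrite scaler0 addr0.
have diff i (x : M i) : x \in smem (Submodule (closed i)) ->
    cdiff M i x \in smem (Submodule (closed (i - 1))).
  by rewrite !inE => /eqP->; rewrite linear0.
exists (Subcomplex diff); split=> [i|].
  by apply: pure_submodule_zero => x /eqP.
apply/hom_acyclic_subP => A _ i f f0 _; exists \0; split=> a.
  by rewrite inE.
by rewrite linear0; apply/esym/eqP/f0.
Qed.

(** Acyclicity of [T] is that of an extension of [Q] by [P]: a map to cycles of
[T] bounds modulo [P] by some [k] into [Q]; a lift [l] of [k] leaves a map to
cycles of [P], which bounds in [P]. *)
Lemma good_subcomplex_preim M (P : subcomplex M) (Q : subcomplex (quot_complex P))
    (T : subcomplex M) :
  (forall i x, x \in smem (T i) <-> quotmod_pi (P i) x \in smem (Q i)) ->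
  good_subcomplex P -> good_subcomplex Q -> good_subcomplex T.
Proof.
move=> TE [Ppure /hom_acyclic_subP Pac] [Qpure /hom_acyclic_subP Qac]; split=> [i|].
  exact: pure_submodule_preim (TE i) (Ppure i) (Qpure i).
have PT i x : x \in smem (P i) -> x \in smem (T i).
  by move=> /quotmod_pi_eq0 x0; apply/TE; rewrite x0; apply: rpred0.
apply/hom_acyclic_subP => A fpA i f fT df0.
have [||k [kQ kE]] := Qac A fpA i (quotmod_pi (P (i - 1)) \o f).
- by move=> a; apply/TE.
- by move=> a; rewrite [LHS]quot_proj_cdiff df0 linear0.
have [l lE] := Ppure i A fpA k.
have [||p [pP pE]] := Pac A fpA i (f \- (cdiff M i \o l)).
- move=> a; apply/quotmod_piP; rewrite -[RHS]/(quotmod_pi _ (cdiff M i (l a))).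
  by rewrite -quot_proj_cdiff lE kE.
- by move=> a; rewrite linearB /= cdiff_cdiff df0 subrr.
exists (l \+ p); split=> a /=; last by rewrite linearD /= pE /= subrKC.
by apply: rpredD; [apply/TE; rewrite lE | apply: PT].
Qed.

(** A map to cycles of the cone is a pair [(f1, f2)] with [d f1 + f2 = 0] modulo
[P] and [d f2 = 0].  Lift [f1] to [l] in [M].  Then [d l + f2] is a map to
cycles of [P], so it is [d p] with [p] into [P], and [(0, l - p)] has
boundary [(f1, f2)]. *)
Lemma quot_proj_pure_quasi_iso M (P : subcomplex M) :
  good_subcomplex P -> pure_quasi_iso (quot_proj P).
Proof.
move=> [Ppure /hom_acyclic_subP Pac]; apply/pure_acyclicP => A fpA i f df0.
have [l lE] := Ppure (i - 1) A fpA (fst \o f).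
have dP a : cdiff M (i - 1) (l a) + (f a).2 \in smem (P (i - 1 - 1)).
  apply/quotmod_pi_eq0; rewrite linearD /= -quot_proj_cdiff lE.
  exact: (congr1 fst (df0 a)).
have df2 a : cdiff M (i - 1 - 1) (f a).2 = 0.
  by apply/eqP; rewrite -oppr_eq0; apply/eqP; exact: (congr1 snd (df0 a)).
have [||p [pP pE]] := Pac A fpA (i - 1) ((cdiff M (i - 1) \o l) \+ (snd \o f)).
- exact: dP.
- by move=> a; rewrite /= linearD /= cdiff_cdiff df2 addr0.
have [|g gE] := @linear_bundle R A (cone (quot_proj P) i)
    (fun a => (0, l a - p a)).
  move=> a x y; congr pair; first by rewrite /= scaler0 addr0.
  exact: (linearP (l \- p) a x y).
exists g => a; rewrite gE [f a]surjective_pairing /= /cone_diff /=; congr pair.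
  by rewrite linear0 add0r linearB /= lE (quotmod_pi_eq0 _ _).2 ?subr0.
by rewrite linearB /= pE opprB /= (addrC (cdiff M (i - 1) (l a))) addrK.
Qed.

End GoodSubcomplexes.

(** * A maximal pure-acyclic pure subcomplex *)

Section Maximal.
Variables (R : pzRingType) (M : complex R).

Definition subcomplex_le (P Q : subcomplex M) : Prop :=
  forall i x, x \in smem (P i) -> x \in smem (Q i).

Lemma subcomplex_directed_union (I : Type) (S : I -> subcomplex M) :
  inhabited I ->
  (forall a b, exists c, subcomplex_le (S a) (S c) /\ subcomplex_le (S b) (S c)) ->
  exists P : subcomplex M,
    forall i x, x \in smem (P i) <-> exists a, x \in smem (S a i).
Proof.
move=> [a0] dirS.
have closed i : submod_closed [pred x : M i | `[< exists a, x \in smem (S a i) >]].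
  split=> [|u x y]; rewrite !inE.
    by exists a0; apply: rpred0.
  move=> [a xa] [b yb].
  have [c [ac bc]] := dirS a b; exists c.
  by apply: rpredD; [apply: rpredZ; apply: ac | apply: bc].
have diff i (x : M i) : x \in smem (Submodule (closed i)) ->
    cdiff M i x \in smem (Submodule (closed (i - 1))).
  rewrite !inE => -[a xa]; exists a.
  exact: subobj_cdiff.
by exists (Subcomplex diff) => i x; split=> [/asboolP|xS] //; apply/asboolP.
Qed.

Lemma maximal_good_subcomplex :
  exists2 P : subcomplex M, good_subcomplex P &
    forall Q, good_subcomplex Q -> subcomplex_le P Q -> subcomplex_le Q P.
Proof.
have [P0 P0good] := good_subcomplex_zero M.
pose T := {P : subcomplex M | good_subcomplex P}.
pose le (P Q : T) := `[< subcomplex_le (sval P) (sval Q) >].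
have [|P Q N /asboolP PQ /asboolP QN|C Ctot|P Pmax] :=
  @ZL_preorder T (exist _ P0 P0good) le.
- by move=> P; apply/asboolP => i x.
- by apply/asboolP => i x /PQ/QN.
(* The empty chain is bounded by any good subcomplex; the union of a nonempty
   chain is good. *)
- case: (pselect (exists Q, C Q)) => [[Q0 CQ0]|C0]; last first.
    by exists (exist _ P0 P0good) => Q CQ; case: C0; exists Q.
  pose I := {Q : T | C Q}; pose S (a : I) := sval (sval a).
  have I0 : inhabited I by split; exists Q0.
  have dirS (a b : I) :
      exists c, subcomplex_le (S a) (S c) /\ subcomplex_le (S b) (S c).
    have [/asboolP ab|/asboolP ba] := Ctot _ _ (svalP a) (svalP b).
      by exists b; split.
    by exists a; split.
  have [U UE] := subcomplex_directed_union I0 dirS.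
  have Ugood : good_subcomplex U.
    apply: (good_subcomplex_directed_union I0 _ UE) => [a b|a].
      have [c [ac bc]] := dirS a b; exists c => i x.
      by case; [apply: ac | apply: bc].
    exact: svalP (sval a).
  exists (exist _ U Ugood) => Q CQ; apply/asboolP => i x xQ; apply/UE.
  by exists (exist _ Q CQ).
exists (sval P); first exact: svalP P.
move=> Q Qgood PQ; have /asboolP := Pmax (exist _ Q Qgood) (introT (asboolP _) PQ).
exact.
Qed.

(** The preimage in [M] of a pure-acyclic pure subcomplex [Q] of [M / P] is good
and contains [P], hence is [P], and so [Q] is zero. *)
Lemma maximal_good_quot_minimal (P : subcomplex M) :
  good_subcomplex P ->
  (forall Q, good_subcomplex Q -> subcomplex_le P Q -> subcomplex_le Q P) ->
  pure_minimal (quot_complex P).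
Proof.
move=> Pgood Pmax Q Qpure /pure_acyclicP Qac i x xQ.
have closed k : submod_closed [pred x : M k | quotmod_pi (P k) x \in smem (Q k)].
  split=> [|a y z]; rewrite !inE ?linear0 ?rpred0 // => yQ zQ.
  by rewrite linearP; apply: rpredD => //; apply: rpredZ.
have diff k (y : M k) : y \in smem (Submodule (closed k)) ->
    cdiff M k y \in smem (Submodule (closed (k - 1))).
  by rewrite !inE -quot_proj_cdiff => /subobj_cdiff.
pose T := Subcomplex diff.
have Tgood : good_subcomplex T.
  apply: (good_subcomplex_preim (Q := Q)) Pgood _ => //.
  by split=> //; apply: pure_subcomplex_degreewise.
have [y yx] := quotmod_pi_surj x; rewrite -yx; apply/quotmod_pi_eq0.
apply: (Pmax T Tgood) => [k z /quotmod_pi_eq0 z0|]; rewrite inE /=.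
  by rewrite z0 rpred0.
by rewrite yx.
Qed.

End Maximal.

Theorem mainTheorem3 (R : pzRingType) (M : complex R) :
  exists P : subcomplex M,
    [/\ chain_pure_short_exact (sub_incl P) (quot_proj P),
        pure_acyclic (sub_complex P),
        pure_minimal (quot_complex P)
      & pure_quasi_iso (quot_proj P)].
Proof.
have [P Pgood Pmax] := maximal_good_subcomplex M; exists P; split.
- exact: good_subcomplex_pure.
- by apply/pure_acyclicP; have [] := Pgood.
- exact: maximal_good_quot_minimal.
- exact: quot_proj_pure_quasi_iso.
Qed.
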